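(* Fix positive integers $k<d$ and let $G=G(k,d)$. Then for each $c\in[d]$, the graph $G_{[d]\setminus\{c\}}$ admits a graphical shelling $\alpha,w^1,w^2,\ldots,w^{\binom{d-1}{k}}$ with $|R(w^j)|=k$ for each $j\ge1$.
   Context: $W_d$ is the set of words of length $d$ over $\{0,1\}$ with first letter $1$; each word is a concatenation of maximal constant nonempty subwords called blocks; $W_d(k)$ is the set of words with exactly $k+1$ blocks. $G'(k,d)$ is the edge-labeled multigraph on $W_d(k)$ with an edge labeled $j$ between two words differing only in position $j$. $G(k,d)$ adds a vertex $\alpha$ and, for each $w\in W_d(k)$ and each $j$ such that $w_j$ is in a block of size one, an edge labeled $j$ from $w$ to $\alpha$. For $S\subseteq[d]$, $G_S$ is the spanning subgraph with the edges whose labels lie in $S$. For a connected multigraph $H$ with edges colored by elements of a finite set $C$, a linear ordering $F_1,\dots,F_r$ of its vertices is a graphical shelling if for each $i\ge1$ the set $\{S\subseteq C:$ every path in $H$ from $F_i$ to some $F_j$ with $j<i$ uses an edge with color in $S\}$ has a unique minimal element, denoted $R(F_i)$. *)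

(* Defs.v *)
From HB Require Import structures.
From mathcomp Require Import all_boot.

Set Implicit Arguments.
Unset Strict Implicit.
Unset Printing Implicit Defensive.

(* An undirected multigraph with edges colored by [C]: [adj c x y] holds when
   an edge of color [c] joins [x] and [y].  Parallel edges of different colors
   are thus allowed; parallel edges of the same color are identified, and none
   occur in the graphs considered here. *)
Record colored_multigraph (C : finType) := ColoredMultigraph {
  vertex :> finType;
  adj : C -> rel vertex;
  adj_sym : forall c, symmetric (adj c)
}.

Section ColoredMultigraph.

Variables (C : finType) (H : colored_multigraph C).
Implicit Types (x y : H) (p : seq (C * H)) (F : seq H) (S : {set C}).

(* A walk from [x] is the list of its steps: the color of the edge that is
   used, and the vertex that is reached. *)
Fixpoint is_walk x p : bool :=
  if p is (c, y) :: p' then adj c x y && is_walk y p' else true.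

(* A path is a walk that repeats no vertex. *)
Definition is_path x p y : bool :=
  [&& is_walk x p, uniq (x :: unzip2 p) & last x (unzip2 p) == y].

Definition connected_graph : Prop := forall x y, exists p, is_path x p y.

Definition meets_colors p S : bool := has (mem S) (unzip1 p).

(* A linear ordering of the vertices is a list [F]; [y] comes before [x] when
   [index y F < index x F]. *)
Definition separates F x S : Prop :=
  forall y p, index y F < index x F -> is_path x p y -> meets_colors p S.

Definition minimal_set (P : {set C} -> Prop) S : Prop :=
  P S /\ forall T : {set C}, P T -> T \subset S -> T = S.

(* [is_restriction F x S] means that [R(x)] is defined and equal to [S]. *)
Definition is_restriction F x S : Prop :=
  unique (minimal_set (separates F x)) S.

Definition graphical_shelling F : Prop :=
  [/\ connected_graph,
      perm_eq F (enum H)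
    & forall x, exists S, is_restriction F x S].

Definition color_adj S (c : C) : rel H := fun x y => (c \in S) && adj c x y.

Lemma color_adj_sym S c : symmetric (color_adj S c).
Proof. by move=> x y; rewrite /color_adj adj_sym. Qed.

Definition color_subgraph S : colored_multigraph C :=
  ColoredMultigraph (color_adj_sym S).

End ColoredMultigraph.

Fixpoint blocks (s : seq bool) : seq (seq bool) :=
  if s is a :: s' then
    if blocks s' is (b :: t) :: bs then
      if a == b then (a :: b :: t) :: bs else [:: a] :: (b :: t) :: bs
    else [:: [:: a]]
  else [::].

Lemma blocks_cons a s : exists n bs, blocks (a :: s) = (a :: nseq n a) :: bs.
Proof.
elim: s a => [|b s IHs] a; first by exists 0, [::].
have [n [bs E]] := IHs b; rewrite /= -/(blocks (b :: s)) E.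
by case: eqP => [->|_]; [exists n.+1, bs | exists 0, ((b :: nseq n b) :: bs)].
Qed.

Lemma blocks_flatten s : flatten (blocks s) = s.
Proof.
elim: s => [|a [|b s] IHs] //.
have [n [bs E]] := blocks_cons b s.
by rewrite -[in RHS]IHs [blocks [:: a, _ & _]]/= -/(blocks (b :: s)) E; case: eqP.
Qed.

Lemma blocks_constant s : all (fun b => (b != [::]) && constant b) (blocks s).
Proof.
elim: s => [|a [|b s] IHs] //.
have [n [bs E]] := blocks_cons b s; move: IHs.
rewrite [blocks [:: a, _ & _]]/= -/(blocks (b :: s)) E /=.
by case: eqP => [->|_] /= /andP[-> ->]; rewrite ?eqxx.
Qed.

Lemma blocks_maximal s :
  sorted (fun b1 b2 => last false b1 != head false b2) (blocks s).
Proof.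
elim: s => [|a [|b s] IHs] //.
have [n [bs E]] := blocks_cons b s; move: IHs.
rewrite [blocks [:: a, _ & _]]/= -/(blocks (b :: s)) E /=.
by case: eqP => [->|/eqP ab] /=; [case: bs {E} | move=> ->; rewrite ab].
Qed.

(* The letter at position [j] of [s] lies in a block of size one.  Here and
   below, positions are numbered from 0. *)
Definition in_singleton_block (s : seq bool) (j : nat) : bool :=
  let sh := shape (blocks s) in nth 0 sh (reshape_index sh j) == 1.

(* [W k d] is the set of words written W_d(k). *)
Definition W (k d : nat) : finType :=
  {w : d.-tuple bool | head false w && (size (blocks w) == k.+1)}.

Definition G'_adj (k d : nat) (j : 'I_d) : rel (W k d) := fun u v =>
  [forall i, (tnth (val u) i != tnth (val v) i) == (i == j)].

Lemma G'_adj_sym k d (j : 'I_d) : symmetric (@G'_adj k d j).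
Proof. by move=> u v; apply: eq_forallb => i; rewrite (eq_sym (tnth (val u) i)). Qed.

Definition G' (k d : nat) : colored_multigraph 'I_d :=
  ColoredMultigraph (@G'_adj_sym k d).

(* The added vertex alpha is [None]. *)
Definition G_adj (k d : nat) (j : 'I_d) : rel (option (W k d)) := fun x y =>
  match x, y with
  | Some u, Some v => @adj _ (G' k d) j u v
  | Some w, None | None, Some w => in_singleton_block (val w) j
  | None, None => false
  end.

Lemma G_adj_sym k d (j : 'I_d) : symmetric (@G_adj k d j).
Proof. by case=> [u|] [v|] //=; rewrite G'_adj_sym. Qed.

Definition G (k d : nat) : colored_multigraph 'I_d :=
  ColoredMultigraph (@G_adj_sym k d).

Definition alpha (k d : nat) : G k d := None.

Definition word_vertex (k d : nat) (w : W k d) : G k d := Some w.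

(* Main.v *)
(** Only the [k] breaks between consecutive unequal letters of a word matter.
    Call [R(w)] the set obtained by picking, for each break of [w], the position
    farther from [c] among the two positions around it; it has [k] elements.
    The words are ordered by the sum over all positions [j] of the number of
    breaks between [j] and [c].

    If [f] agrees with [w] at [c] and on [R(w)], then there are, for each [j], at
    least as many breaks of [f] as of [w] between [j] and [c], because both
    numbers have the same parity at each [j] in [R(w)].  A path from [w] avoiding
    the colors in [R(w)] freezes these letters.  It thus never goes down in the
    order, and it never reaches [alpha]: flipping a block of size one at an
    unfrozen position would yield a word with fewer breaks than [w].  Conversely,
    an edge from [w] with a color in [R(w)] leads to [alpha] or moves a break
    away from [c], which lowers the sum. *)
Require Import Defs.
From mathcomp Require Import all_boot zify.

Set Implicit Arguments.
Unset Strict Implicit.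
Unset Printing Implicit Defensive.

(** * Breaks of binary sequences and the effect of one flip *)

Definition brk (f : nat -> bool) (i : nat) : bool := f i != f i.+1.

Definition nbrk (f : nat -> bool) (n : nat) : nat := \sum_(i < n) brk f i.

Definition flip (f : nat -> bool) (j i : nat) : bool := f i (+) (i == j).

Lemma nbrkS f n : nbrk f n.+1 = nbrk f n + brk f n.
Proof. by rewrite /nbrk big_ord_recr. Qed.

Lemma odd_nbrk f n : odd (nbrk f n) = f 0 (+) f n.
Proof.
elim: n => [|n IHn]; first by rewrite /nbrk big_ord0 addbb.
by rewrite nbrkS oddD IHn oddb /brk; case: (f 0) (f n) (f n.+1) => [] [] [].
Qed.

Lemma nbrkD f m n : nbrk f (m + n) = nbrk f m + nbrk (fun i => f (m + i)) n.
Proof.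
by rewrite /nbrk big_split_ord; congr (_ + _); apply: eq_bigr => i _ /=; rewrite /brk addnS.
Qed.

Lemma nbrk_rev f n : nbrk (fun i => f (n - i)) n = nbrk f n.
Proof.
rewrite /nbrk [RHS](reindex_inj rev_ord_inj); apply: eq_bigr => i _ /=.
by rewrite /brk -subSn ?subSS // eq_sym.
Qed.

Lemma brk_flip f j i : brk (flip f j) i = brk f i (+) ((i == j) (+) (i.+1 == j)).
Proof. by rewrite /brk /flip; case: (f i) (f i.+1) (i == j) (i.+1 == j) => [] [] [] []. Qed.

(** A flip at [j] toggles the breaks [j.-1] and [j] and no others. Lost and gained breaks stand on
    opposite sides, which avoids truncated subtraction. *)
Lemma nbrk_flip f j n :
  nbrk (flip f j) n + ((0 < j <= n) && brk f j.-1) + ((j < n) && brk f j) =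
  nbrk f n + ((0 < j <= n) && ~~ brk f j.-1) + ((j < n) && ~~ brk f j).
Proof.
elim: n => [|n IHn]; first by case: j => [|j]; rewrite /nbrk !big_ord0.
rewrite !nbrkS brk_flip.
case: (ltngtP j n) => [ltjn | ltnj | eqjn].
- have -> : (n.+1 == j) = false by lia.
  by move: IHn; case: (brk f j.-1) (brk f j) => [] []; rewrite /= addbF; lia.
- by case: (ltngtP n.+1 j) => [lt|//|eqj]; rewrite ?addbF; [lia | lia |
    subst j; case: (brk f n) IHn => /=; lia].
subst n; have -> : (j.+1 == j) = false by lia.
by move: IHn; case: (brk f j.-1) (brk f j) => [] []; rewrite /=; lia.
Qed.

(** At a break [i] of [g] the two counts up to [i.+1] have equal parity. If they were equal up to
    [i], then [f] must break there too. *)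
Lemma leq_nbrk f g m :
    f 0 = g 0 -> (forall i, i < m -> brk g i -> f i.+1 = g i.+1) ->
  forall i, i <= m -> nbrk g i <= nbrk f i.
Proof.
move=> fg0 fg; elim=> [|i IHi] ltim; first by rewrite /nbrk big_ord0.
have := IHi (ltnW ltim); rewrite !nbrkS; case: (boolP (brk g i)) => [bgi|_]; last by lia.
have := odd_nbrk f i.+1; rewrite fg0 (fg i ltim bgi) -odd_nbrk !nbrkS bgi.
by case: (brk f i); lia.
Qed.

(** * Blocks expressed through breaks *)

Lemma size_blocks a s : size (blocks (a :: s)) = (nbrk (nth false (a :: s)) (size s)).+1.
Proof.
elim: s a => [|b s IHs] a; first by rewrite /nbrk big_ord0.
have := IHs b; have [n [bs E]] := blocks_cons b s.
rewrite [blocks [:: a, _ & _]]/= -/(blocks (b :: s)) E -[size (b :: s)]add1n nbrkD.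
have -> : nbrk (nth false [:: a, b & s]) 1 = (a != b) by rewrite nbrkS /nbrk big_ord0.
by case: (eqVneq a b) => _ /= ->.
Qed.

Local Arguments reshape_index : simpl never.

Lemma reshape_index_cons m sh j :
  reshape_index (m :: sh) j = if j < m then 0 else (reshape_index sh (j - m)).+1.
Proof. by rewrite /reshape_index /= subn_eq0; case: ltnP => // lemj; rewrite subSn. Qed.

Lemma in_singleton_blockE s j : j < size s ->
  in_singleton_block s j =
    ((j == 0) || (brk (nth false s) j.-1)) &&
    ((j.+1 == size s) || (brk (nth false s) j)).
Proof.
rewrite /in_singleton_block.
elim: s j => [|a [|b s] IHs] // j; first by case: j.
have := IHs j.-1; have [n [bs E]] := blocks_cons b s.
rewrite [blocks [:: a, _ & _]]/= -/(blocks (b :: s)) E.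
case: j => [_ _ | [|j]] /=.
- by rewrite /brk /=; case: (eqVneq a b) => [->|]; rewrite reshape_index_cons /= ?eqxx.
- move=> /(_ isT) IH _; rewrite {1}/brk /=.
  by case: (eqVneq a b) => _ /=; rewrite ?reshape_index_cons.
move=> IH ltj; move: (IH ltj).
case: (eqVneq a b) => _ /=; rewrite ?[in X in _ -> X]reshape_index_cons /= ?subn1 //.
rewrite !reshape_index_cons !ltnS !subSS size_nseq.
by case: ltnP => [ltjn|_] <- //; case: (n) ltjn.
Qed.

(** * Breaks counted outward from [c], and domination *)

Definition radial_nbrk c f j :=
  nbrk (fun i => f (c - i)) (c - j) + nbrk (fun i => f (c + i)) (j - c).

Definition potential c n f := \sum_(j < n.+1) radial_nbrk c f j.

(** The position [bump c i] is the end of the pair [i], [i.+1] farther from [c]; [lift c] is its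
    version on ordinals. *)
Definition dominated c n (g f : nat -> bool) :=
  f c = g c /\ forall i, i < n -> brk g i -> f (bump c i) = g (bump c i).

(** Truncated subtraction empties one of the two sums, so only the breaks on the side of [j]
    count. *)
Lemma odd_radial_nbrk c f j : odd (radial_nbrk c f j) = f c (+) f j.
Proof.
rewrite oddD !odd_nbrk subn0 addn0; case: (leqP j c) => [lejc | /ltnW lecj].
  by rewrite subKn // (_ : j - c = 0) ?addn0 ?addbb ?addbF //; apply/eqP.
by rewrite subnKC // (_ : c - j = 0) ?subn0 ?addbb //; apply/eqP.
Qed.

Lemma nbrk_radial c n f : c <= n -> nbrk f n = radial_nbrk c f 0 + radial_nbrk c f n.
Proof.
move=> lecn; rewrite -{1}(subnKC lecn) nbrkD -nbrk_rev /radial_nbrk sub0n subn0.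
by rewrite (_ : c - n = 0) /nbrk ?big_ord0 ?addn0 //; apply/eqP.
Qed.

Section Domination.

Context (c n : nat) (f g : nat -> bool) (lecn : c <= n) (dom_fg : dominated c n g f).

Lemma leq_radial_nbrk j : j <= n -> radial_nbrk c g j <= radial_nbrk c f j.
Proof.
have [fgc fg] := dom_fg; move=> lejn; apply: leq_add.
  (* Read leftward from [c], the break [i] is the break [c - i.+1] of [g], whose farther end is its
     left one. *)
  apply: (@leq_nbrk _ _ c); rewrite ?subn0 ?leq_subr // => i ltic.
  have ltci : c - i.+1 < c by lia.
  rewrite /brk eq_sym -{2}[i]/(i.+1.-1) (_ : c - i = (c - i.+1).+1); last by lia.
  by move/(fg _ (leq_trans ltci lecn)); rewrite /bump leqNgt ltci.
apply: (@leq_nbrk _ _ (n - c)); rewrite ?addn0 ?leq_sub2r // => i ltin.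
rewrite /brk addnS => bgi; have := fg (c + i).
by rewrite /bump leq_addr add1n; apply => //; lia.
Qed.

Lemma leq_nbrk_dominated : nbrk g n <= nbrk f n.
Proof. by rewrite !(nbrk_radial _ lecn) leq_add ?leq_radial_nbrk. Qed.

Lemma leq_potential : potential c n g <= potential c n f.
Proof. by apply: leq_sum => j _; rewrite leq_radial_nbrk // -ltnS. Qed.

(** The sums compare term by term, so equality forces equal radial counts, and their parities
    determine the letters. *)
Lemma eq_potential : potential c n f <= potential c n g -> forall j, j <= n -> f j = g j.
Proof.
move=> le_fg j lejn; have [fgc _] := dom_fg.
have /leqif_sum le_r (i : 'I_n.+1) (_ : true) :
    radial_nbrk c g i <= radial_nbrk c f i ?= iff (radial_nbrk c g i == radial_nbrk c f i).
  by split; first exact: leq_radial_nbrk (ltn_ord i).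
have := le_r; rewrite -/(potential c n g) -/(potential c n f) => -[_].
rewrite eqn_leq leq_potential le_fg => /esym/forallP/(_ (Ordinal (lejn : j < n.+1)))/eqP/=.
by move=> /(congr1 odd); rewrite !odd_radial_nbrk fgc => /addbI.
Qed.

End Domination.

(** * Words as sequences of letters *)

Definition letter k d (w : W k d) : nat -> bool := nth false (val w).

Lemma letterE k d (w : W k d) (j : 'I_d) : letter w j = tnth (val w) j.
Proof. by rewrite /letter (tnth_nth false). Qed.

Lemma word_inj k n (u v : W k n.+1) : (forall j, j <= n -> letter u j = letter v j) -> u = v.
Proof.
move=> uv; apply/val_inj/eq_from_tnth => j.
by rewrite -!letterE uv // -ltnS.
Qed.

Lemma letter0 k n (w : W k n.+1) : letter w 0 = true.
Proof. by rewrite /letter nth0; case/andP: (valP w). Qed.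

Lemma size_blocks_tuple n (t : n.+1.-tuple bool) :
  size (blocks t) = (nbrk (nth false t) n).+1.
Proof. by case: t => -[|a s] // /= /eqP[<-]; apply: size_blocks. Qed.

Lemma nbrk_letter k n (w : W k n.+1) : nbrk (letter w) n = k.
Proof.
by apply: succn_inj; rewrite -(size_blocks_tuple (val w)); case/andP: (valP w) => _ /eqP.
Qed.

Lemma eq_nbrk f g n : (forall i, i <= n -> f i = g i) -> nbrk f n = nbrk g n.
Proof. by move=> fg; apply: eq_bigr => i _; rewrite /brk !fg // ltnW. Qed.

Lemma word_of_letters k n (f : nat -> bool) :
  f 0 -> nbrk f n = k -> exists w : W k n.+1, forall j, j <= n -> letter w j = f j.
Proof.
move=> f0 fk; pose t := [tuple f i | i < n.+1].
have tE j : j <= n -> nth false t j = f j.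
  by move=> lejn; rewrite -[j]/(val (Ordinal (lejn : j < n.+1))) -tnth_nth tnth_mktuple.
have tW : head false t && (size (blocks t) == k.+1).
  by rewrite size_blocks_tuple (eq_nbrk tE) fk eqxx andbT -nth0 tE.
by exists (Sub t tW).
Qed.

Lemma in_singleton_block_letter k n (w : W k n.+1) j : j <= n ->
  in_singleton_block (val w) j =
    ((j == 0) || brk (letter w) j.-1) && ((j == n) || brk (letter w) j).
Proof. by move=> lejn; rewrite in_singleton_blockE size_tuple. Qed.

Lemma G'_adjP k n (u v : W k n.+1) (j : 'I_n.+1) :
  reflect (forall i, i <= n -> letter v i = flip (letter u) j i) (G'_adj j u v).
Proof.
apply: (iffP forallP) => [uv i lein | uv i].
  have /eqP := uv (Ordinal (lein : i < n.+1)); rewrite -!letterE /flip /=.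
  rewrite -val_eqE /=; case: (i == j) (letter u i) (letter v i) => [] [] [] //.
rewrite -!letterE uv; last exact: (ltn_ord i : i <= n).
rewrite /flip -val_eqE /=.
by case: (letter u i) (i == j :> nat) => [] [].
Qed.

(** * Restriction sets, the number of words, and moves between words *)

Definition inner_labels k n (c : 'I_n.+1) (w : W k n.+1) : {set 'I_n.+1} :=
  [set lift c i | i in [set i : 'I_n | brk (letter w) i]].

Lemma card_breaks k n (w : W k n.+1) : #|[set i : 'I_n | brk (letter w) i]| = k.
Proof.
rewrite -[RHS](nbrk_letter w) /nbrk -sum1_card big_mkcond /=.
by apply: eq_bigr => i _; rewrite inE; case: brk.
Qed.

Lemma card_inner_labels k n (c : 'I_n.+1) (w : W k n.+1) : #|inner_labels c w| = k.
Proof. by rewrite card_imset ?card_breaks //; apply: lift_inj. Qed.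

(** A word starting with 1 is determined by its set of breaks, which can be any [k]-subset of the
    [n] gaps. *)
Lemma card_W k n : #|W k n.+1| = 'C(n, k).
Proof.
pose breaks (w : W k n.+1) := [set i : 'I_n | brk (letter w) i].
have breaks_inj : injective breaks.
  move=> u v /setP uv; apply: word_inj => j lejn.
  have : odd (nbrk (letter u) j) = odd (nbrk (letter v) j).
    congr odd; apply: eq_bigr => i _; have := uv (widen_ord lejn i).
    by rewrite !inE => ->.
  by rewrite !odd_nbrk !letter0 => /addbI.
rewrite -cardsT -(card_imset _ breaks_inj) -[n in RHS]card_ord -card_draws.
apply: eq_card => A; rewrite inE; apply/imsetP/eqP => [[w _ ->] | cardA].
  exact: card_breaks.
(* Membership in [A] is extended to all naturals; [f] starts at 1 and switches after each element of
   [A]. *)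
pose a i := [exists x in A, val x == i].
pose f i := ~~ odd (\sum_(l < i) a l).
have brkf (i : 'I_n) : brk f i = (i \in A).
  have -> : (i \in A) = a i.
    by apply/idP/existsP => [iA | [x /andP[xA /eqP/val_inj <-]]] //; exists i; rewrite iA /=.
  by rewrite /brk /f big_ord_recr /= oddD oddb; case: odd (a i) => [] [].
have [w wE] : exists w : W k n.+1, forall j, j <= n -> letter w j = f j.
  apply: word_of_letters; first by rewrite /f big_ord0.
  rewrite /nbrk -cardA -sum1_card [RHS]big_mkcond.
  by apply: eq_bigr => i _; rewrite brkf; case: (i \in A).
exists w => //; apply/setP => i; rewrite inE -brkf /brk !wE //; exact: ltnW.
Qed.

Lemma dominatedP k n (c : 'I_n.+1) (w : W k n.+1) f :
  reflect (dominated c n (letter w) f)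
          [forall j : 'I_n.+1, (j \in c |: inner_labels c w) ==> (f j == letter w j)].
Proof.
apply: (iffP forall_inP) => [fw | [fwc fw] j].
  split=> [|i ltin bwi]; first by apply/eqP/fw; rewrite setU11.
  apply/eqP; apply: (fw (lift c (Ordinal ltin))).
  by rewrite setU1r // imset_f // inE.
case/setU1P => [->|]; first by rewrite fwc.
by case/imsetP => i; rewrite inE => bwi ->; rewrite /= fw.
Qed.

Lemma dominated_flip k n (c j : 'I_n.+1) (w : W k n.+1) f :
  j \notin c |: inner_labels c w -> dominated c n (letter w) f ->
  dominated c n (letter w) (flip f j).
Proof.
move=> jNw /dominatedP/forall_inP fw; apply/dominatedP/forall_inP => i iw.
rewrite /flip (_ : (i == j :> nat) = false) ?addbF ?fw //.
by apply/negbTE/eqP => /val_inj eq_ij; rewrite -eq_ij iw in jNw.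
Qed.

Lemma dominated_G'_adj k n (c j : 'I_n.+1) (u v w : W k n.+1) :
  j \notin c |: inner_labels c w -> G'_adj j u v ->
  dominated c n (letter w) (letter u) -> dominated c n (letter w) (letter v).
Proof.
move=> jNw /G'_adjP uv /(dominated_flip jNw)/dominatedP/forall_inP fw.
by apply/dominatedP/forall_inP => i iw; rewrite uv ?fw // -ltnS.
Qed.

(** Flipping a block of size one would leave fewer than [k] breaks, while the result still dominates
    [w], which has [k]. *)
Lemma dominated_no_singleton k n (c j : 'I_n.+1) (u w : W k n.+1) :
  0 < n -> j \notin c |: inner_labels c w -> dominated c n (letter w) (letter u) ->
  ~~ in_singleton_block (val u) j.
Proof.
move=> n_gt0 jNw /(dominated_flip jNw)/(leq_nbrk_dominated (ltn_ord c : c <= n)).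
have lejn : j <= n by rewrite -ltnS.
have := nbrk_flip (letter u) j n; rewrite !nbrk_letter in_singleton_block_letter //.
move=> E le_k; apply/negP => /andP[]; move: E le_k n_gt0 lejn.
by case: (brk _ j) (brk _ j.-1) => [] []; lia.
Qed.

(** Since [j] is the farther end of a break and its block is longer than one, flipping it pushes
    that break one step away from [c]. *)
Lemma descent k n (c j : 'I_n.+1) (w : W k n.+1) :
    j \in inner_labels c w -> ~~ in_singleton_block (val w) j ->
  exists2 v, G'_adj j w v & potential c n (letter v) < potential c n (letter w).
Proof.
case/imsetP => i; rewrite inE => bwi def_j; have lejn : j <= n by rewrite -ltnS.
have def_jn : j = bump c i :> nat by rewrite def_j.
rewrite in_singleton_block_letter // => jNs.
have ltin : i < n := ltn_ord i.
have bfi : ~~ brk (flip (letter w) j) i.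
  by rewrite brk_flip bwi def_jn /bump; case: leqP; lia.
(* If [j] were 0, the break after it would make the first letter a block of size one. *)
have [j_gt0 nbf] : 0 < j /\ nbrk (flip (letter w) j) n = k.
  move: jNs def_jn (nbrk_flip (letter w) j n); rewrite nbrk_letter /bump.
  case: (leqP c i) => _ jNs /=; rewrite ?add1n ?add0n => def_jn; move: jNs; rewrite def_jn /= bwi.
    by case: (brk _ i.+1); lia.
  case: (brk _ i.-1); rewrite ?orbT ?orbF ?andbT ?andbF /= -?lt0n => // i_gt0.
  by rewrite i_gt0 ltin (ltnW ltin); lia.
have [|v vE] := word_of_letters _ nbf.
  by rewrite /flip letter0 (ltn_eqF j_gt0).
exists v; first exact/G'_adjP.
(* The roles are reversed: [w] dominates [v], because they differ only at [j], the farther end of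
   the pair [i], where [v] has no break. *)
have dom_vw : dominated c n (letter v) (letter w).
  split=> [|i' lti'n].
    rewrite vE /flip; last by rewrite -ltnS.
    by rewrite def_jn (negbTE (neq_bump c i)) addbF.
  have ltbn : bump c i' <= n by rewrite /bump; case: (c <= i'); lia.
  case: (eqVneq i' i) => [-> | neq_ii' _].
    rewrite /brk (vE i) ?(ltnW ltin) // (vE i.+1) //.
    by rewrite -/(brk (flip (letter w) j) i) (negbTE bfi).
  by rewrite vE // /flip def_jn (can_eq (@bumpK c)) (negbTE neq_ii') addbF.
rewrite ltnNge; apply/negP => /(eq_potential (ltn_ord c : c <= n) dom_vw)/(_ j lejn).
by rewrite vE // /flip eqxx; case: letter.
Qed.

(** * Paths and least separating sets *)

Section ColoredMultigraph.

Context (C : finType) (H : colored_multigraph C).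
Implicit Types (x y : H) (F : seq H) (S : {set C}).

Lemma connect_is_path x y :
  connect (fun u v => [exists c, @adj C H c u v]) x y -> exists p, is_path x p y.
Proof.
case/connectP => q /shortenP[q' q'_path q'_uniq _] ->.
have [p p_walk def_q'] : exists2 p, is_walk x p & unzip2 p = q'.
  elim: q' x q'_path {q'_uniq} => [|z q' IHq] x /=; first by exists [::].
  case/andP => /existsP[c xz] /IHq[p p_walk <-].
  by exists ((c, z) :: p); rewrite //= xz.
by exists p; rewrite /is_path p_walk def_q' q'_uniq eqxx.
Qed.

Lemma is_restrictionI F x S :
    separates F x S -> (forall T : {set C}, separates F x T -> S \subset T) ->
  is_restriction F x S.
Proof.
move=> sepS minS; split.
  by split=> // T /minS sST sTS; apply/eqP; rewrite eqEsubset sTS.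
by move=> T [sepT minT]; apply: minT => //; apply: minS.
Qed.

End ColoredMultigraph.

Theorem theorem4p13 (k d : nat) (k_gt0 : 0 < k) (lt_kd : k < d) (c : 'I_d) :
  exists w : 'C(d.-1, k).-tuple (W k d),
    let H := color_subgraph (G k d) [set~ c] in
    let F : seq H := alpha k d :: map (@word_vertex k d) w in
    graphical_shelling F /\
    forall j : 'I_('C(d.-1, k)),
      exists2 R : {set 'I_d},
        is_restriction F (word_vertex (tnth w j) : H) R & #|R| = k.
Proof.
case: d => // n in lt_kd c *; have n_gt0 : 0 < n by lia.
pose pot (w : W k n.+1) := potential c n (letter w).
pose ws := sort (relpre pot leq) (enum (W k n.+1)).
have mem_ws w : w \in ws by rewrite mem_sort mem_enum.
have ws_uniq : uniq ws by rewrite sort_uniq enum_uniq.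
have size_ws : size ws == 'C(n.+1.-1, k) by rewrite size_sort -cardE card_W.
exists (Tuple size_ws) => H F.
have indexF w : index (word_vertex w : H) F = (index w ws).+1.
  by rewrite /F /= index_map //; apply: Some_inj.
(* Ties in the potential are broken arbitrarily, so only the weak inequality holds. *)
have leq_pot u v : index (word_vertex u : H) F < index (word_vertex v : H) F -> pot u <= pot v.
  rewrite !indexF ltnS => /ltnW le_uv.
  have tr : transitive (relpre pot leq) by move=> y x z; apply: leq_trans.
  have ws_sorted : sorted (relpre pot leq) ws by apply: sort_sorted => x y; apply: leq_total.
  by apply: (sorted_leq_index tr _ ws_sorted) => // x; apply: leqnn.
have ltn_pot u v : pot u < pot v -> index (word_vertex u : H) F < index (word_vertex v : H) F.
  rewrite ltnNge; apply: contraR; rewrite -leqNgt leq_eqVlt => /predU1P[|/leq_pot//].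
  by rewrite !indexF => -[/index_inj->].
have labelNc j (w : W k n.+1) : j \in inner_labels c w -> j != c.
  by case/imsetP => i _ ->; rewrite eq_sym neq_lift.
have descentH w j : j \in inner_labels c w -> exists2 y : H,
    @adj _ H j (word_vertex w) y & index y F < index (word_vertex w : H) F.
  move=> jw; have jc := labelNc _ _ jw.
  case: (boolP (in_singleton_block (val w) j)) => [jw1 | /(descent jw)[v wv lt_vw]].
    by exists (alpha k n.+1) => //; rewrite /= /color_adj in_setC1 jc.
  by exists (word_vertex v); [rewrite /= /color_adj in_setC1 jc | apply: ltn_pot].
have restr w : is_restriction F (word_vertex w : H) (inner_labels c w).
  apply: is_restrictionI => [y p lt_yw /and3P[p_walk _ /eqP last_p] | T sepT].
    apply/negPn/negP => pNw.
    (* A word [u] that dominates [w] and comes earlier has potential at most that of [w], hence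
       equals [w]. *)
    suff [u dom_u def_y] : exists2 u, dominated c n (letter w) (letter u) & y = word_vertex u.
      move: lt_yw; rewrite def_y => lt_uw.
      have /word_inj eq_uw := eq_potential (ltn_ord c : c <= n) dom_u (leq_pot _ _ lt_uw).
      by rewrite eq_uw ltnn in lt_uw.
    have: dominated c n (letter w) (letter w) by split.
    rewrite -{}last_p {lt_yw}; move: {1 4 6}w p_walk pNw => u.
    elim: p u => [|[j z] p IHp] u /=; first by exists u.
    rewrite /color_adj in_setC1 /meets_colors /= negb_or => /andP[/andP[jc uz] p_walk].
    case/andP => jw pNw dom_u.
    have jNw : j \notin c |: inner_labels c w by rewrite !inE negb_or jc.
    case: z uz p_walk => [v | ] /= uv p_walk.
      exact: (IHp v p_walk pNw (dominated_G'_adj jNw uv dom_u)).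
    by rewrite (negPf (dominated_no_singleton n_gt0 jNw dom_u)) in uv.
  (* The single edge colored [j] is already a path to an earlier vertex, so every separating set
     contains [j]. *)
  apply/subsetP => j jw; have [y wy lt_yw] := descentH _ _ jw.
  have : is_path (word_vertex w : H) [:: (j, y)] y.
    apply/and3P; split; [by move: wy => /= -> | rewrite /= inE andbT | exact: eqxx].
    by apply: contraTneq lt_yw => <-; rewrite ltnn.
  by move/(sepT _ _ lt_yw); rewrite /meets_colors /= orbF.
split; last by move=> j; exists (inner_labels c (tnth (Tuple size_ws) j));
  [apply: restr | apply: card_inner_labels].
split.
- move=> x y; apply: connect_is_path.
  pose e := [rel u v : H | [exists j, @adj _ H j u v]].
  have e_sym : connect_sym e.
    by apply: sym_connect_sym => u v; apply: eq_existsb => j; apply: adj_sym.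
  suff to_alpha z : connect e z (alpha k n.+1).
    by apply: connect_trans (to_alpha x) _; rewrite e_sym to_alpha.
  have [m] := ubnP (index z F); elim: m z => // m IHm [w|//] lt_wm.
  (* As [k] is positive, some label leads to an earlier vertex. *)
  have /card_gt0P[j jw] : 0 < #|inner_labels c w| by rewrite card_inner_labels.
  have [z wz lt_zw] := descentH _ _ jw.
  apply: connect_trans (connect1 _) (IHm z (leq_trans lt_zw lt_wm)).
  by apply/existsP; exists j.
- apply: uniq_perm; rewrite ?enum_uniq //=.
    rewrite map_inj_uniq ?ws_uniq ?andbT //; last exact: Some_inj.
    by apply/mapP => -[].
  move=> [w|]; rewrite mem_enum inE ?eqxx //=.
  by rewrite map_f ?orbT.
case=> [w|]; first by exists (inner_labels c w); apply: restr.
(* No vertex precedes [alpha], so the empty set separates. *)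
exists set0; apply: is_restrictionI => [y p|T _]; last exact: sub0set.
by rewrite /F /=.
Qed.
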